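(* For every positive integer $n$, there exist uncountably many real numbers $y$ such that $|L(y)|=2n$.
   Context: Let $\phi(x)=\operatorname{dist}(x,\mathbb{Z})$; the Takagi function is $T(x)=\sum_{n=0}^\infty 2^{-n}\phi(2^nx)$, and $L(y)=\{x\in[0,1]:T(x)=y\}$. $|\cdot|$ denotes cardinality. *)

(* Defs.v *)
From mathcomp Require Import all_boot all_order all_algebra.
From mathcomp Require Import all_classical all_reals all_analysis.

Set Implicit Arguments.
Unset Strict Implicit.
Unset Printing Implicit Defensive.

Import Order.TTheory GRing.Theory Num.Theory.
Import numFieldNormedType.Exports.

Local Open Scope classical_set_scope.
Local Open Scope ring_scope.

Definition dist_int (R : realType) (x : R) : R :=
  inf (range (fun m : int => `|x - m%:~R|)).

Definition takagi (R : realType) (x : R) : R :=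
  limn (series (fun n => 2 ^- n * dist_int (2 ^+ n * x))).

Definition takagi_level (R : realType) (y : R) : set R :=
  [set x | 0 <= x <= 1 /\ takagi x = y].

(* Main.v *)
(** Restricting the Takagi function [T] to a dyadic interval and rescaling gives
    [f_k x = T x + k x] on [[0, 1]] for an integer [k], up to an additive constant.
    Let [N_k y] be the number of solutions of [f_k x = y]. Splitting [[0, 1]] at [1/2]
    gives, for [k >= 1] and [y <> (k + 1) / 2],
      [N_k y = N_(k+1) (2 y) + N_(k-1) (2 y - 1 - k)],
      [N_0 y = 2 N_1 (2 y)] if [y <> 1/2],
    and for [k >= 0] the range of [f_k] lies in [[0, k + (2/3) 2^-k]]. If the
    fractional parts of all [2^j t] avoid [[0, 1/6]], then at most one of the two terms
    is ever nonzero along the orbit of [(k, t)], so [N_k t = 1] when [k >= 1] and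
    [0 < t < k]. For such [t] in [[2/3, 11/15]], with [w = t / 2^(2m+1)],
      [N_2 (2 + w) = N_1 (1 + 2 w) = N_2 (2 + 4 w) + N_0 (4 w)],
    which gives [N_2 (2 + w) = 2 m] by induction on [m]. Then
      [N_0 (1/2 + w) = 2 N_1 (1 + 2 w) = 4 m] for [m >= 1], and
      [N_0 ((3 + w / 2) / 8) = 2 (N_1 (w / 2) + N_2 (2 + w)) = 2 (2 m + 1)].
    Uncountably many [t] are available: the numbers whose base-16 digits are all
    10 (1010) or 11 (1011). *)

Require Import Defs.
From mathcomp Require Import all_boot all_order all_algebra.
From mathcomp Require Import all_classical all_reals all_analysis.
From mathcomp Require Import finmap ring lra.

Set Implicit Arguments.
Unset Strict Implicit.

Import Order.TTheory GRing.Theory Num.Theory.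
Import numFieldNormedType.Exports.

Local Open Scope classical_set_scope.
Local Open Scope card_scope.
Local Open Scope ring_scope.

(** * Preliminaries on limits, cardinalities and series *)

Lemma ler_halving (R : realType) (a b c : R) :
  (forall n, a <= b + c / 2 ^+ n) -> a <= b.
Proof.
move=> h; rewrite leNgt; apply/negP => ba.
have ab0 : 0 < a - b by rewrite subr_gt0.
(* The Archimedean bound [n] exceeds [c / (a - b)], and [2 ^+ n] exceeds [n]. *)
pose n := Num.bound `|c / (a - b)|.
have hn : c / (a - b) < 2 ^+ n.
  apply: le_lt_trans (ler_norm _) _; apply: lt_trans (archi_boundP (normr_ge0 _)) _.
  by rewrite -natrX ltr_nat ltn_expl.
have := h n; rewrite leNgt => /negP; apply.
rewrite -ltrBrDl ltr_pdivrMr ?exprn_gt0//.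
by rewrite mulrC -ltr_pdivrMr.
Qed.

Lemma card_setU_II (T : choiceType) (A B : set T) (m n : nat) :
  A `&` B = set0 -> A #= `I_m -> B #= `I_n -> A `|` B #= `I_(m + n).
Proof.
move=> AB0 Am Bn.
have [X AX] : exists X : {fset T}, A = [set` X].
  by apply/finite_fsetP; apply/finite_setP; exists m.
have [Y BY] : exists Y : {fset T}, B = [set` Y].
  by apply/finite_fsetP; apply/finite_setP; exists n.
move: Am Bn AB0; rewrite {}AX {}BY => /card_eq_fsetP <- /card_eq_fsetP <- XY.
have -> : [set` X] `|` [set` Y] = [set` (X `|` Y)%fset].
  by apply/seteqP; split => x /=; rewrite in_fsetU => /orP.
apply/card_eq_fsetP; rewrite cardfsU.
suff -> : (X `&` Y)%fset = fset0 by rewrite cardfs0 subn0.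
apply/fsetP => x; rewrite in_fsetI in_fset0.
apply/negP => /andP[xX xY].
by have : ([set` X] `&` [set` Y]) x by []; rewrite XY.
Qed.

Lemma limn_series_recl (R : realType) (u : R ^nat) : cvgn (series u) ->
  limn (series u) = u 0%N + limn (series (fun n => u n.+1)).
Proof.
move=> cu.
have e : series (fun n => u n.+1) = [sequence - u 0%N + series u n.+1]_n.
  by apply/funext => n; rewrite /series /= big_nat_recl// addKr.
have : [sequence - u 0%N + series u n.+1]_n @ \oo --> - u 0%N + limn (series u).
  by apply: cvgD; [exact: cvg_cst | rewrite (cvg_shiftS (series u))].
by rewrite e => /cvg_lim -> //; rewrite addNKr.
Qed.

(** * Distance to the nearest integer *)

Section DistInt.
Variable R : realType.
Implicit Types x y : R.
Local Notation D x := (range (fun m : int => `|x - m%:~R|)).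

Let has_lbound_dist x : has_lbound (D x).
Proof. by exists 0 => _ [m _ <-]. Qed.

Let dist_nonempty x : D x !=set0.
Proof. by exists `|x - 0%:~R|; exists 0. Qed.

Lemma dist_int_ge0 x : 0 <= dist_int x.
Proof. by apply: lb_le_inf => // _ [m _ <-]. Qed.

Lemma dist_int_le x (m : int) : dist_int x <= `|x - m%:~R|.
Proof. by apply: ge_inf => //; exists m. Qed.

Lemma dist_int_half x : dist_int x <= 1 / 2.
Proof.
have /andP[h1 h2] := floor_itv x.
have := dist_int_le x (Num.floor x); have := dist_int_le x (Num.floor x + 1).
move: h1 h2; rewrite intrD; set f := (Num.floor x)%:~R => h1 h2.
rewrite ler0_norm; last lra.
rewrite ger0_norm; lra.
Qed.

Lemma dist_int_lip x y : dist_int x <= dist_int y + `|x - y|.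
Proof.
rewrite -lerBlDr; apply: lb_le_inf => // _ [m _ <-]; rewrite lerBlDr.
apply: le_trans (dist_int_le x m) _.
have -> : x - m%:~R = (y - m%:~R) + (x - y) by ring.
exact: ler_normD.
Qed.

Lemma dist_intDz x (m : int) : dist_int (x + m%:~R) = dist_int x.
Proof.
rewrite /dist_int; congr inf; apply/seteqP; split => _ [k _ <-].
  by exists (k - m) => //=; congr `|_|; rewrite intrB; ring.
by exists (k + m) => //=; congr `|_|; rewrite intrD; ring.
Qed.

Lemma dist_intN x : dist_int (- x) = dist_int x.
Proof.
rewrite /dist_int; congr inf; apply/seteqP; split => _ [k _ <-];
  by exists (- k) => //=; rewrite intrN -opprD normrN // ?opprK.
Qed.

Lemma dist_int_id x : 0 <= x <= 1 / 2 -> dist_int x = x.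
Proof.
move=> /andP[x0 x1]; apply/eqP; rewrite eq_le; apply/andP; split.
  by have := dist_int_le x 0; rewrite subr0 ger0_norm.
apply: lb_le_inf => // _ [m _ <-].
have [m0|m0] := leP m 0.
  have : m%:~R <= 0 :> R by rewrite lerz0.
  by move=> ?; rewrite ger0_norm; lra.
have : 1 <= m%:~R :> R by rewrite ler1z.
by move=> ?; rewrite ler0_norm; lra.
Qed.

End DistInt.

(** * Functional equations, bounds and continuity of the Takagi function *)

Section Takagi.
Variable R : realType.
Implicit Types x y t : R.

Let takagi_term x (n : nat) : R := 2 ^- n * dist_int (2 ^+ n * x).

Let takagi_term_ge0 x n : 0 <= takagi_term x n.
Proof. by rewrite mulr_ge0 ?dist_int_ge0// invr_ge0 exprn_ge0. Qed.

Let takagi_term_le x n : takagi_term x n <= geometric (1 / 2) (1 / 2) n.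
Proof.
rewrite /takagi_term /geometric /= mulrC div1r exprVn.
by rewrite ler_wpM2r ?invr_ge0 ?exprn_ge0// -div1r dist_int_half.
Qed.

Let half_lt1 : `|1 / 2 : R| < 1.
Proof. by rewrite ger0_norm; lra. Qed.

Let is_cvg_takagi x : cvgn (series (takagi_term x)).
Proof.
apply: series_le_cvg (takagi_term_ge0 x) _ (takagi_term_le x) _.
  by move=> n; exact: le_trans (takagi_term_ge0 x n) (takagi_term_le x n).
exact: is_cvg_geometric_series.
Qed.

Lemma takagi_ge0 x : 0 <= takagi x.
Proof.
have <- : series (takagi_term x) 0%N = 0 by rewrite /series /= big_geq.
apply: nondecreasing_cvgn_le; last exact: is_cvg_takagi.
by apply: nondecreasing_series => n _ _.
Qed.

Lemma takagi_le1 x : takagi x <= 1.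
Proof.
have h := @cvg_geometric_series R (1 / 2) (1 / 2) half_lt1.
apply: (@le_trans _ _ (limn (series (geometric (1 / 2 : R) (1 / 2))))).
  apply: lim_series_le; [exact: is_cvg_takagi|exact: cvgP h|].
  exact: takagi_term_le.
by rewrite (cvg_lim (@Rhausdorff R) h) ler_pdivrMr; lra.
Qed.

Lemma takagi_dist_int x : takagi x = dist_int x + takagi (2 * x) / 2.
Proof.
rewrite {1}/takagi (limn_series_recl (@is_cvg_takagi x)) /=; congr (_ + _).
  by rewrite /takagi_term expr0 invr1 !mul1r.
have -> : (fun n => 2 ^- n.+1 * dist_int (2 ^+ n.+1 * x)) =
    2^-1 *: takagi_term (2 * x).
  apply/funext => n; rewrite [in dist_int _]exprSr exprS invfM -!mulrA.
  exact: erefl.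
rewrite lim_seriesZ //.
exact: mulrC.
Qed.

Lemma takagiDz x (m : int) : takagi (x + m%:~R) = takagi x.
Proof.
rewrite /takagi; congr (limn (series _)); apply/funext => n; congr (_ * _).
by rewrite mulrDr -natrX -(intrM _ (2 ^ n)%N m) dist_intDz.
Qed.

Lemma takagi_left x : 0 <= x <= 1 -> takagi (x / 2) = (takagi x + x) / 2.
Proof.
move=> x01; rewrite takagi_dist_int dist_int_id; last lra.
by rewrite (_ : 2 * (x / 2) = x); lra.
Qed.

Lemma takagi_right x :
  0 <= x <= 1 -> takagi ((1 + x) / 2) = (takagi x + 1 - x) / 2.
Proof.
move=> x01; rewrite takagi_dist_int.
rewrite -dist_intN -(dist_intDz _ 1) dist_int_id; last lra.
rewrite (_ : 2 * ((1 + x) / 2) = x + 1%:~R); last lra.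
by rewrite takagiDz; lra.
Qed.

Lemma takagi0 : takagi (0 : R) = 0.
Proof. by have := @takagi_left 0; rewrite mul0r => /(_ _)/wrap[]; lra. Qed.

Lemma takagi1 : takagi (1 : R) = 0.
Proof. by rewrite -[1]add0r (takagiDz 0 1) takagi0. Qed.

Lemma takagi_reflect x : takagi (1 - x) = takagi x.
Proof.
rewrite addrC (takagiDz (- x) 1) /takagi.
congr (limn (series _)); apply/funext => n; congr (_ * _).
by rewrite mulrN dist_intN.
Qed.

(** Two successive terms of the series add up to at most 1/2, so [T t <= 1/2 + T (4 t) / 4]; the
    value 2/3 is the fixed point of [c = 1/2 + c / 4]. *)
Lemma takagi_le x : takagi x <= 2 / 3.
Proof.
have two_steps t : takagi t <= 1 / 2 + takagi (2 * (2 * t)) / 4.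
  rewrite takagi_dist_int (takagi_dist_int (2 * t)).
  suff : dist_int t + dist_int (2 * t) / 2 <= 1 / 2 by lra.
  have [m m_lt m_gt] : exists2 m : int, m%:~R <= t & t < m%:~R + 1.
    by exists (Num.floor t); have /andP[] := floor_itv t; rewrite ?intrD.
  have d0 := dist_int_le t m; have d1 := dist_int_le t (m + 1).
  have e0 := dist_int_le (2 * t) (2 * m).
  have e1 := dist_int_le (2 * t) (2 * m + 1).
  have e2 := dist_int_le (2 * t) (2 * m + 2).
  move: d0 d1 e0 e1 e2; rewrite !intrD !intrM /= => d0 d1 e0 e1 e2.
  (* On either half of [[m, m + 1]], the distance from [t] to the nearer end plus half the distance
     from [2 t] to [2 m + 1] is exactly 1/2. *)
  have [|] := leP t (m%:~R + 1 / 2) => ?.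
    by rewrite ger0_norm in d0; last lra; move: e1; rewrite ler0_norm; lra.
  by rewrite ler0_norm in d1; last lra; move: e1; rewrite ger0_norm; lra.
have h n : forall t, takagi t <= 2 / 3 + 1 / 2 ^+ n.
  elim: n => [t|n IH t]; first by have := takagi_le1 t; rewrite expr0; lra.
  have := two_steps t; have := IH (2 * (2 * t)).
  have : 0 < (2 : R) ^- n by rewrite invr_gt0 exprn_gt0.
  rewrite exprS invfM; lra.
exact: ler_halving (fun n => h n x).
Qed.

(** On the left half, doubling [x] lowers the slope by one and doubles the constant term; right of
    1/2 the affine bound is already at least 2/3. *)
Lemma takagi_le_affine (k : nat) x : 0 <= x <= 1 ->
  takagi x <= k%:R * x + 2 / 3 / 2 ^+ k.
Proof.
elim: k x => [x _|k IH x x01].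
  by have := takagi_le x; rewrite mul0r expr0; lra.
have q0 : 0 < (2 : R) ^- k by rewrite invr_gt0 exprn_gt0.
rewrite exprS invfM -(natr1 k).
have [xle|xgt] := leP x (1 / 2).
  have /IH : 0 <= 2 * x <= 1 by lra.
  have := @takagi_left (2 * x); rewrite (_ : 2 * x / 2 = x); last lra.
  by move=> ->; lra.
case: k IH q0 => [|k] _ q0; first by have := takagi_le x; rewrite expr0; lra.
have : 0 <= k%:R * x by rewrite mulr_ge0 ?ler0n//; lra.
by have := takagi_le x; rewrite -(natr1 k); lra.
Qed.

(** Each use of the functional equation adds [|x - y|], since [dist_int] is 1-Lipschitz, and halves
    the remaining error. *)
Lemma takagi_modulus (n : nat) x y :
  `|takagi x - takagi y| <= n%:R * `|x - y| + 1 / 2 ^+ n.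
Proof.
elim: n x y => [x y|n IH x y].
  rewrite mul0r add0r expr0 divr1 ler_norml.
  by have := takagi_le1 x; have := takagi_le1 y; have := takagi_ge0 x;
     have := takagi_ge0 y; lra.
rewrite (takagi_dist_int x) (takagi_dist_int y) exprS invfM -(natr1 n).
have := IH (2 * x) (2 * y); rewrite -mulrBr normrM ger0_norm//.
have := dist_int_lip x y; have := dist_int_lip y x; rewrite (distrC y x).
rewrite !ler_norml; lra.
Qed.

Lemma continuous_takagi : continuous (@takagi R).
Proof.
move=> x; apply/cvgrPdist_le => e e0.
have [n hn] : exists n, 1 / 2 ^+ n <= e / 2.
  apply: contrapT => /forallNP h.
  suff : e / 2 <= 0 by lra.
  apply: (@ler_halving _ _ _ 1) => n; rewrite add0r.
  by have /negP := h n; rewrite -ltNge => /ltW.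
near=> y.
apply: le_trans (takagi_modulus n x y) _.
suff : n%:R * `|x - y| <= e / 2 by lra.
have : `|x - y| <= e / 2 / n.+1%:R.
  near: y; apply: (cvgr_dist_le (V := R^o)) => //.
  by rewrite !divr_gt0.
rewrite ler_pdivlMr//; apply: le_trans; rewrite mulrC.
by rewrite ler_wpM2l// ler_nat.
Unshelve. all: by end_near.
Qed.

End Takagi.

(** * Level sets of the tilted functions [T x + k x] *)

Definition tilted_level (R : realType) (k : nat) (y : R) : set R :=
  [set x | 0 <= x <= 1 /\ takagi x + k%:R * x = y].

(* The fractional part of every [2 ^+ j * t] avoids [[0, 1/6]]. *)
Definition shift_gap (R : realType) (t : R) : Prop :=
  forall (j : nat) (a : int), ~ 0 <= 2 ^+ j * t - a%:~R <= 1 / 6.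

Section TiltedLevels.
Variable R : realType.
Implicit Types (x y z t : R) (k m n : nat).

Lemma tilted_level0 y : tilted_level 0 y = takagi_level y.
Proof.
by apply/seteqP; split => x /=; rewrite /tilted_level /takagi_level /= mul0r addr0.
Qed.

Lemma tilted_level_set0 k y :
  y < 0 \/ k%:R + 2 / 3 / 2 ^+ k < y -> tilted_level k y = set0.
Proof.
move=> hy; apply/seteqP; split => // x [x01 xy].
have := takagi_ge0 x; have : 0 <= k%:R * x by rewrite mulr_ge0 ?ler0n//; lra.
(* By the symmetry of [T], the affine bound at [1 - x] becomes an upper bound for [T x + k x]. *)
have h : takagi (1 - x) <= k%:R * (1 - x) + 2 / 3 / 2 ^+ k.
  by apply: takagi_le_affine; lra.
move: h; rewrite takagi_reflect.
by case: hy; lra.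
Qed.

(** The right half would have tilt -1, outside [nat]; the symmetry of [T] turns it into a mirrored
    copy of the left half. *)
Lemma tilted_level_half0 z : tilted_level 0 (z / 2) =
  [set x / 2 | x in tilted_level 1 z] `|`
  [set 1 - x / 2 | x in tilted_level 1 z].
Proof.
apply/seteqP; split => [x [x01]|x [|] [u [u01 uz] <-]].
- have [xle|xgt] := leP x (1 / 2).
    rewrite -{1}(_ : 2 * x / 2 = x); last lra.
    rewrite takagi_left; last lra.
    move=> e; left; exists (2 * x); last lra.
    by split; lra.
  rewrite -takagi_reflect -{1}(_ : 2 * (1 - x) / 2 = 1 - x); last lra.
  rewrite takagi_left; last lra.
  move=> e; right; exists (2 * (1 - x)); last lra.
  by split; lra.
- by split; rewrite ?takagi_left//; lra.
- by split; rewrite ?takagi_reflect ?takagi_left//; lra.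
Qed.

Lemma tilted_level_halfS k z : tilted_level k.+1 (z / 2) =
  [set x / 2 | x in tilted_level k.+2 z] `|`
  [set (1 + x) / 2 | x in tilted_level k (z - k.+2%:R)].
Proof.
rewrite /tilted_level -!(natr1 k.+1) -!(natr1 k).
apply/seteqP; split => [x [x01]|x [|] [u [u01 uz] <-]].
- have [xle|xgt] := leP x (1 / 2).
    rewrite -{1}(_ : 2 * x / 2 = x); last lra.
    rewrite takagi_left; last lra.
    move=> e; left; exists (2 * x); last lra.
    by split; lra.
  rewrite -{1}(_ : (1 + (2 * x - 1)) / 2 = x); last lra.
  rewrite takagi_right; last lra.
  move=> e; right; exists (2 * x - 1); last lra.
  by split; lra.
- by split; rewrite ?takagi_left//; lra.
- by split; rewrite ?takagi_right//; lra.
Qed.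

Lemma card_tilted_level0 m z : z <> 1 ->
  tilted_level 1 z #= `I_m -> tilted_level 0 (z / 2) #= `I_(m + m).
Proof.
move=> z1 zm; rewrite tilted_level_half0; apply: card_setU_II.
(* The two halves can meet only at 1/2, which is a solution only for [z = 1]. *)
- apply/seteqP; split => // x [[u [u01 uz] <-] [v [v01 vz]] uv].
  have u1 : u = 1 by lra.
  by apply: z1; rewrite -uz u1 takagi1; lra.
- by apply: card_eq_trans zm; apply: inj_card_eq => u v _ _; lra.
- by apply: card_eq_trans zm; apply: inj_card_eq => u v _ _; lra.
Qed.

Lemma card_tilted_levelS k m n z : z <> k.+2%:R ->
  tilted_level k.+2 z #= `I_m -> tilted_level k (z - k.+2%:R) #= `I_n ->
  tilted_level k.+1 (z / 2) #= `I_(m + n).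
Proof.
move=> zk zm zn; rewrite tilted_level_halfS; apply: card_setU_II.
- apply/seteqP; split => // x [[u [u01 uz] <-] [v [v01 vz]] uv].
  have u1 : u = 1 by lra.
  by apply: zk; rewrite -uz u1 takagi1; lra.
- by apply: card_eq_trans zm; apply: inj_card_eq => u v _ _; lra.
- by apply: card_eq_trans zn; apply: inj_card_eq => u v _ _; lra.
Qed.

Lemma tilted_level_neq0 k y : 0 <= y <= k%:R -> tilted_level k y !=set0.
Proof.
move=> yk.
have cf : {within `[0, 1], continuous (fun x => takagi x + k%:R * x)}.
  apply: continuous_subspaceT => x; apply: cvgD.
    exact: continuous_takagi.
  by apply: cvgM; [exact: cvg_cst|exact: cvg_id].
have [] := IVT ler01 cf (v := y).
  rewrite takagi0 takagi1 mulr0 mulr1 addr0 add0r.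
  by rewrite min_l ?max_r ?ler0n.
by move=> x; rewrite in_itv /= => x01 xy; exists x.
Qed.

Lemma shift_gap_shift t (j : nat) (a : int) :
  shift_gap t -> shift_gap (2 ^+ j * t - a%:~R).
Proof.
move=> tg i b; have := tg (i + j)%N (2 ^+ i * a + b).
by rewrite intrD intrM rmorphXn /= exprD mulrBr mulrA opprD addrA.
Qed.

(* The two halves of [[0, 1]] only compete for [y] when [2 y - k.+2] lies in
   [[0, 1/6]], and [y < k.+1] is preserved and keeps the tilt positive. *)
Lemma tilted_level_close (n k : nat) y x x' : shift_gap y -> 0 < y < k.+1%:R ->
  tilted_level k.+1 y x -> tilted_level k.+1 y x' -> x - x' <= 1 / 2 ^+ n.
Proof.
elim: n k y x x' => [|n IH] k y x x' yg yk.
  by move=> [x01 _] [x01' _]; rewrite expr0; lra.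
have gap : ~ 0 <= 2 * y - k.+2%:R <= 1 / 6 := yg 1%N k.+2.
have q : 0 < (2 : R) ^- k by rewrite invr_gt0 exprn_gt0.
have q1 : (2 : R) ^- k <= 1 by rewrite invf_le1 ?exprn_gt0// exprn_ege1// ler1n.
rewrite -(_ : 2 * y / 2 = y) 1?tilted_level_halfS; last lra.
have gl : shift_gap (2 * y).
  by rewrite -(subr0 (2 * y)); exact: (@shift_gap_shift y 1 0).
have gr : shift_gap (2 * y - k.+2%:R) by exact: (@shift_gap_shift y 1 k.+2).
rewrite exprS invfM.
have [lt_y|le_y] := ltP (2 * y) k.+2%:R.
  rewrite (@tilted_level_set0 k) ?image_set0 ?setU0; last by left; lra.
  move=> [u ul <-] [u' ul' <-].
  have gl_itv : 0 < 2 * y < k.+2%:R by lra.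
  by have := IH _ _ _ _ gl gl_itv ul ul'; lra.
(* The gap gives [2 y - k.+2 > 1/6], and 1/6 is (2/3) 2^-2, so [2 y] lies above the range for tilt
   [k.+2]. *)
rewrite (@tilted_level_set0 k.+2) ?image_set0 ?set0U; last first.
  right; rewrite !exprS !invfM; lra.
move=> [u ul <-] [u' ul' <-].
(* Tilt 0 cannot arise: [y < 1] contradicts [2 <= 2 * y]. *)
case: k => [|k] in yk le_y gap gr ul ul' q q1 *; first by lra.
have gr_itv : 0 < 2 * y - k.+3%:R < k.+1%:R.
  by move: yk le_y gap; rewrite -(natr1 k.+2) -(natr1 k.+1); lra.
by have := IH _ _ _ _ gr gr_itv ul ul'; lra.
Qed.

(** Existence comes from the intermediate value theorem; uniqueness holds because two solutions
    differ by at most 2^-n for every [n]. *)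
Lemma card_tilted_level_gap k t :
  shift_gap t -> 0 < t < k.+1%:R -> tilted_level k.+1 t #= `I_1.
Proof.
move=> tg tk; have [x xt] : tilted_level k.+1 t !=set0.
  by apply: tilted_level_neq0; lra.
suff -> : tilted_level k.+1 t = [set` [fset x]%fset].
  by apply/card_eq_fsetP; rewrite cardfs1.
apply/seteqP; split => x' /=; rewrite inE; last by move=> /eqP ->.
move=> xt'; rewrite eq_le; apply/andP; split; rewrite -subr_le0;
  apply: (@ler_halving _ _ _ 1) => n; rewrite add0r;
  exact: (tilted_level_close n tg tk).
Qed.

End TiltedLevels.

(** * Exact solution counts for an admissible parameter [t] *)

Section LevelCounts.
Variables (R : realType) (t : R).
Hypotheses (t_gap : shift_gap t) (t_itv : 2 / 3 <= t <= 11 / 15).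

Let scaled_itv (i : nat) : 0 < t / 2 ^+ i <= 11 / 15.
Proof.
have t_gt0 : 0 < t by move: t_itv; lra.
rewrite divr_gt0 ?exprn_gt0//=.
rewrite ler_pdivrMr ?exprn_gt0//.
have : 1 <= (2 : R) ^+ i by rewrite exprn_ege1// ler1n.
by move: t_itv; lra.
Qed.

(** The induction covers all tilts at once because the left half raises the tilt; the right half is
    empty, its level being negative. *)
Lemma card_tilted_level_scaled (k i : nat) :
  tilted_level k.+1 (t / 2 ^+ i) #= `I_1.
Proof.
elim: i k => [|i IH] k.
  have : 1 <= k.+1%:R :> R by rewrite ler1n.
  by rewrite expr0 divr1 => ?; apply: card_tilted_level_gap => //; move: t_itv; lra.
have := scaled_itv i.
have : 2 <= k.+2%:R :> R by rewrite ler_nat.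
move=> ? ?; rewrite exprSr invfM mulrA.
rewrite -[1%N]addn0; apply: card_tilted_levelS; [lra|exact: IH|].
by rewrite tilted_level_set0 ?II0 ?card_eqxx//; left; lra.
Qed.

Lemma card_tilted_level0_scaled (i : nat) :
  tilted_level 0 (t / 2 ^+ i.+1) #= `I_2.
Proof.
rewrite exprSr invfM mulrA; apply: (@card_tilted_level0 _ 1).
  by have := scaled_itv i; lra.
exact: card_tilted_level_scaled.
Qed.

Lemma card_tilted_level_near_overlap (m : nat) :
  tilted_level 2 (2 + t / 2 ^+ (2 * m).+1) #= `I_(2 * m) /\
  tilted_level 1 (1 + t / 2 ^+ (2 * m).+2) #= `I_(2 * m).+2.
Proof.
have step1 i k : tilted_level 2 (2 + t / 2 ^+ i.+1) #= `I_k ->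
    tilted_level 1 (1 + t / 2 ^+ i.+2) #= `I_k.+2.
  move=> h; rewrite (_ : 1 + _ = (2 + t / 2 ^+ i.+1) / 2); last first.
    by rewrite (exprSr _ i.+1) invfM; lra.
  have := scaled_itv i.+1 => ?; rewrite -[k.+2]addn2.
  apply: card_tilted_levelS => //; first lra.
  by rewrite addrC addKr; exact: card_tilted_level0_scaled.
(* The left half has tilt 3 and a level above 4, out of range, so only the right half counts. *)
have step2 i k : tilted_level 1 (1 + t / 2 ^+ i) #= `I_k ->
    tilted_level 2 (2 + t / 2 ^+ i.+1) #= `I_k.
  move=> h; rewrite (_ : 2 + _ = (4 + t / 2 ^+ i) / 2); last first.
    by rewrite exprSr invfM; lra.
  have := scaled_itv i => ?; rewrite -[k]add0n.
  apply: card_tilted_levelS; first lra.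
    rewrite tilted_level_set0 ?II0 ?card_eqxx//; right.
    by rewrite !exprS expr0 mulr1 !invfM; lra.
  by rewrite (_ : 4 + _ - _ = 1 + t / 2 ^+ i)//; lra.
elim: m => [|m [_ IH]].
  (* Since [t / 2 >= 1/3], the level exceeds 2 + 1/6, the upper bound for tilt 2. *)
  suff h : tilted_level 2 (2 + t / 2 ^+ 1) #= `I_0 by split => //; exact: step1.
  rewrite II0 card_eq0 tilted_level_set0//; right.
  by move: t_itv; rewrite expr1 exprS expr1 invfM; lra.
by rewrite mulnS add2n; split; [exact: step2|apply: step1; exact: step2].
Qed.

(** The level is written as an affine function of [t] with nonzero slope, so that distinct
    parameters give distinct levels. *)
Lemma card_takagi_level_even (m : nat) :
  takagi_level (1 / 2 + 2 ^- (2 * m).+3 * t) #= `I_(2 * (2 * m).+2).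
Proof.
rewrite -tilted_level0 (mul2n (2 * m)%N.+2) -addnn.
rewrite (_ : 1 / 2 + _ = (1 + t / 2 ^+ (2 * m).+2) / 2); last first.
  by rewrite (exprSr _ (2 * m)%N.+2) invfM; lra.
apply: card_tilted_level0; first by have := scaled_itv (2 * m)%N.+2; lra.
by have [] := card_tilted_level_near_overlap m.
Qed.

(** Doubling leads from [(3 + v) / 8] at tilt 0 to [(3 + v) / 2] at tilt 2. This splits into one
    solution at level [v], tilt 1, and, through tilt 3, the [2 * m] solutions at level [2 + 2 * v],
    tilt 2. *)
Lemma card_takagi_level_odd (m : nat) :
  takagi_level (3 / 8 + 2 ^- (2 * m).+2 / 8 * t) #= `I_(2 * (2 * m).+1).
Proof.
rewrite -tilted_level0 (mul2n (2 * m)%N.+1) -addnn.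
set v := t / 2 ^+ (2 * m).+2.
have v_itv : 0 < v <= 11 / 15 by exact: scaled_itv.
have v_le : v <= 11 / 60.
  have := scaled_itv (2 * m)%N; rewrite /v 2!exprSr !invfM; lra.
rewrite (_ : 3 / 8 + _ = (3 + v) / 2 / 2 / 2); last first.
  by rewrite /v; lra.
apply: card_tilted_level0; first lra.
rewrite -[(2 * m)%N.+1]addn0; apply: card_tilted_levelS; first lra.
  rewrite -[(2 * m)%N.+1]addn1; apply: card_tilted_levelS; first lra.
    rewrite (_ : 3 + v = (6 + 2 * v) / 2); last lra.
    rewrite -[(2 * m)%N]add0n; apply: card_tilted_levelS; first lra.
      rewrite II0 card_eq0 tilted_level_set0//; right.
      by rewrite !exprS expr0 mulr1 !invfM; lra.
    rewrite (_ : 6 + 2 * v - _ = 2 + t / 2 ^+ (2 * m).+1).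
      by have [] := card_tilted_level_near_overlap m.
    by rewrite /v (exprSr _ _.+1) invfM; lra.
  rewrite addrAC subrr add0r; exact: card_tilted_level_scaled.
by rewrite II0 card_eq0 tilted_level_set0//; left; lra.
Qed.

End LevelCounts.

(** * A Cantor set of admissible parameters *)

Section GapCantorSet.
Variable R : realType.
Implicit Types s : nat -> bool.

Let digit s (i : nat) : R := (10 + (s i)%:R) / 16 ^+ i.+1.

Definition gap_cantor s : R := limn (series (digit s)).

Let digit_bounds s i :
  geometric (10 / 16) (1 / 16) i <= digit s i <= geometric (11 / 16) (1 / 16) i.
Proof.
have q : 0 < (16 : R) ^- i by rewrite invr_gt0 exprn_gt0.
rewrite /digit /geometric /= div1r exprVn exprS invfM.
by case: (s i) => /=; lra.
Qed.

Let sixteenth_lt1 : `|1 / 16 : R| < 1.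
Proof. by rewrite ger0_norm; lra. Qed.

Let is_cvg_digit s : cvgn (series (digit s)).
Proof.
have q i : 0 < (1 / 16 : R) ^+ i by rewrite exprn_gt0.
apply: (@series_le_cvg _ _ (geometric (11 / 16) (1 / 16))).
- by move=> i; have := digit_bounds s i; have := q i; rewrite /geometric /=; lra.
- by move=> i; have := q i; rewrite /geometric /=; lra.
- by move=> i; have /andP[] := digit_bounds s i.
- exact: is_cvg_geometric_series.
Qed.

(** The endpoints are the sums with all digits 10 and all digits 11. *)
Lemma gap_cantor_itv s : 2 / 3 <= gap_cantor s <= 11 / 15.
Proof.
have cvg_geo (a : R) := @cvg_geometric_series R a _ sixteenth_lt1.
have lim_geo (a : R) : limn (series (geometric a (1 / 16 : R))) = a * 16 / 15.
  by rewrite (cvg_lim (@Rhausdorff R) (cvg_geo a)); field.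
apply/andP; split.
  rewrite (_ : 2 / 3 = 10 / 16 * 16 / 15); last lra.
  rewrite -lim_geo; apply: lim_series_le; [exact: cvgP (cvg_geo _)|done|].
  by move=> i; have /andP[] := digit_bounds s i.
rewrite (_ : 11 / 15 = 11 / 16 * 16 / 15); last lra.
rewrite -lim_geo; apply: lim_series_le; [done|exact: cvgP (cvg_geo _)|].
by move=> i; have /andP[] := digit_bounds s i.
Qed.

Lemma gap_cantor_shift s :
  16 * gap_cantor s = 10 + (s 0%N)%:R + gap_cantor (fun i => s i.+1).
Proof.
rewrite {1}/gap_cantor (limn_series_recl (@is_cvg_digit s)).
have -> : (fun n => digit s n.+1) = 16^-1 *: digit (fun i => s i.+1).
  apply/funext => i; rewrite /digit exprS invfM mulrCA; exact: erefl.
rewrite lim_seriesZ// [_ *: _](_ : _ = 16^-1 * gap_cantor (fun i => s i.+1))//.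
by rewrite /digit expr1; lra.
Qed.

(** The tails lie in an interval of length less than 1, so the leading digit is determined by the
    sum. *)
Lemma gap_cantor_inj : injective gap_cantor.
Proof.
move=> s s' e; apply/funext => i.
elim: i s s' e => [|i IH] s s' e; have := gap_cantor_shift s;
  rewrite e gap_cantor_shift; have := gap_cantor_itv (fun i => s i.+1);
  have := gap_cantor_itv (fun i => s' i.+1).
  by case: (s 0%N); case: (s' 0%N) => //=; lra.
move=> h h' e'; apply: (IH (fun i => s i.+1) (fun i => s' i.+1)).
by move: e'; case: (s 0%N); case: (s' 0%N) => //=; lra.
Qed.

(** Shifting by four binary places drops one base-16 digit, so only [j < 4] needs checking. There
    the integer parts 0, 1, 2, 5 are the binary prefixes of 101, common to both digits. *)
Lemma shift_gap_gap_cantor s : shift_gap (gap_cantor s).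
Proof.
move=> j; elim/ltn_ind: j s => j IH s a.
have h := gap_cantor_itv s.
have notint (b c : int) (x : R) :
  b%:~R + 1 / 6 < x < b%:~R + 1 -> ~ 0 <= x - c%:~R <= 1 / 6.
  move=> hx hc; have [cb|bc] := leP c b.
    by have : c%:~R <= b%:~R :> R; [rewrite ler_int|lra].
  have : (b + 1)%:~R <= c%:~R :> R by rewrite ler_int lezD1.
  by rewrite intrD; lra.
case: j IH => [|[|[|[|j]]]] IH.
- by apply: (notint 0); rewrite expr0; lra.
- by apply: (notint 1); rewrite expr1; lra.
- by apply: (notint 2); rewrite !exprS expr0; lra.
- by apply: (notint 5); rewrite !exprS expr0; lra.
have lt_j : (j < j.+4)%N by have := leq_addr 3 j.+1; rewrite addn3.
pose b : int := a - 2 ^+ j * (10 + (s 0%N)%:Z).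
have -> : 2 ^+ j.+4 * gap_cantor s - a%:~R =
    2 ^+ j * gap_cantor (fun i => s i.+1) - b%:~R.
  have -> : 2 ^+ j.+4 = 2 ^+ j * 16 :> R by rewrite !exprSr; ring.
  rewrite -mulrA gap_cantor_shift /b intrB intrM rmorphXn /= intrD -pmulrn.
  by ring.
exact: IH.
Qed.

End GapCantorSet.

(** * Cantor's diagonal argument and the conclusion *)

Lemma uncountable_bool_seq (f : (nat -> bool) -> nat) : ~ injective f.
Proof.
move=> f_inj.
(* By injectivity, [d] disagrees at place [f s] with every sequence [s], hence also with itself. *)
pose d n := ~~ `[< exists s, f s = n /\ s n >].
have [] := pselect (exists s, f s = f d /\ s (f d)).
  move=> h; have hd : d (f d) = false by rewrite {1}/d asboolT.
  by case: h => s [/f_inj ->]; rewrite hd.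
by move=> h; apply: (h); exists d; split => //; rewrite {1}/d asboolF.
Qed.

Unset Implicit Arguments.

Theorem theorem5p1 (R : realType) (n : nat) (hn : (0 < n)%N) :
  ~ countable [set y : R | takagi_level y #= `I_(2 * n)].
Proof.
(* Both parities of [n] yield one injective affine family of levels. *)
have [[a c] /= c0 level] : exists2 ac : R * R, ac.2 != 0 & forall t,
    shift_gap t -> 2 / 3 <= t <= 11 / 15 ->
    takagi_level (ac.1 + ac.2 * t) #= `I_(2 * n).
  have nE := odd_double_half n; rewrite -mul2n in nE.
  move: (odd n) n./2 nE => [] m /= nE.
    exists (3 / 8, 2 ^- (2 * m).+2 / 8) => [|t tg ti] /=.
      by rewrite ?mulf_neq0// invr_neq0// expf_neq0.
    by rewrite -nE; exact: card_takagi_level_odd.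
  (* Positivity of [n] excludes half of [n] being 0 here, which accounts for the index shift in the
     even case. *)
  case: m nE hn => [<- //|m nE _].
  exists (1 / 2, 2 ^- (2 * m).+3) => [|t tg ti] /=.
    by rewrite ?mulf_neq0// invr_neq0// expf_neq0.
  by rewrite -nE add0n mulnS; exact: card_takagi_level_even.
(* Countability would give an injection from binary sequences into [nat]. *)
move=> /countable_injP[g g_inj].
apply: (@uncountable_bool_seq (fun s => g (a + c * gap_cantor R s))) => s s'.
have in_level u : a + c * gap_cantor R u \in
    [set y : R | takagi_level y #= `I_(2 * n)].
  apply/mem_set/level; first exact: shift_gap_gap_cantor.
  exact: gap_cantor_itv.
move=> /(g_inj _ _ (in_level s) (in_level s'))/addrI/(mulfI c0).
exact: gap_cantor_inj.
Qed.
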